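(* Given positive integers $v_1,v_2,\ldots,v_r$ with $v_1+v_2+\cdots+v_r=n$, there exists a proper spacelike Dupin hypersurface in $\mathbb{R}^{n+1}_1$ with $r$ distinct principal curvatures having respective multiplicities $v_1,v_2,\ldots,v_r$.
   Context: $\mathbb{R}^{n+1}_1$ denotes $\mathbb{R}^{n+1}$ with $\langle X,Y\rangle_1=-x_1y_1+\sum_{j=2}^{n+1}x_jy_j$. A spacelike hypersurface is a smooth immersion $x:M^n\to \mathbb{R}^{n+1}_1$ of an $n$-manifold whose induced metric is positive definite; its principal curvatures are the eigenvalues of its shape operator with respect to a unit (timelike) normal. A curvature surface of $M^n$ is a smooth connected submanifold $S$ such that for each $p\in S$ the tangent space $T_pS$ equals a principal space (eigenspace of the shape operator) at $p$. The hypersurface is Dupin if along each curvature surface the associated principal curvature is constant; it is proper Dupin if moreover the number of distinct principal curvatures is constant on $M^n$. (The hypersurface is not required to be complete or compact.) *)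

(* Defs.v *)
From HB Require Import structures.
From mathcomp Require Import all_boot all_order all_algebra.
From mathcomp Require Import all_classical all_reals all_analysis.
From mathcomp Require Import ring.
Set Implicit Arguments.
Unset Strict Implicit.
Unset Printing Implicit Defensive.
Import Order.TTheory GRing.Theory Num.Theory.
Import numFieldNormedType.Exports.
Local Open Scope classical_set_scope.
Local Open Scope ring_scope.

(* [f] is a total function whose values outside the open set [U] are
   irrelevant.  C^(k+1) means Fréchet differentiable with all directional
   derivatives of class C^k. *)
Fixpoint Ck_on (R : realType) (V W : normedModType R) (k : nat)
    (U : set V) (f : V -> W) : Prop :=
  match k with
  | 0%N => forall y, U y -> {for y, continuous f}
  | k'.+1 => (forall y, U y -> differentiable f y) /\
             (forall v : V, Ck_on k' U (fun y => 'D_v f y))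
  end.

Definition smooth_on (R : realType) (V W : normedModType R)
    (U : set V) (f : V -> W) : Prop := forall k, Ck_on k U f.

(* [chart_map] and [chart_inv] are total functions; they are mutually inverse
   homeomorphisms between [chart_dom] and [chart_cod]. *)
Record chart (R : realType) (T : topologicalType) (n : nat) := Chart {
  chart_dom : set T;
  chart_cod : set 'rV[R]_n;
  chart_map : T -> 'rV[R]_n;
  chart_inv : 'rV[R]_n -> T;
  chart_dom_open : open chart_dom;
  chart_cod_open : open chart_cod;
  chart_map_cod : forall p, chart_dom p -> chart_cod (chart_map p);
  chart_inv_dom : forall y, chart_cod y -> chart_dom (chart_inv y);
  chart_mapK : forall p, chart_dom p -> chart_inv (chart_map p) = p;
  chart_invK : forall y, chart_cod y -> chart_map (chart_inv y) = y;
  chart_map_continuous :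
    forall p, chart_dom p -> {for p, continuous chart_map};
  chart_inv_continuous :
    forall y, chart_cod y -> {for y, continuous chart_inv} }.

(* [chart_at p] is a preferred chart around [p]; the tangent space at [p] is
   identified with R^n (row vectors) through this chart. *)
Record manifold (R : realType) (n : nat) := Manifold {
  carrier :> topologicalType;
  manifold_hausdorff : hausdorff_space carrier;
  manifold_second_countable : @second_countable carrier;
  atlas : set (chart R carrier n);
  chart_at : carrier -> chart R carrier n;
  chart_at_atlas : forall p, atlas (chart_at p);
  chart_at_dom : forall p, chart_dom (chart_at p) p;
  atlas_compatible : forall c d, atlas c -> atlas d ->
    smooth_on [set y | chart_cod c y /\ chart_dom d (chart_inv c y)]
      (chart_map d \o chart_inv c) }.

Definition smooth_fun (R : realType) (n m : nat) (M : manifold R n)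
    (f : M -> 'rV[R]_m) : Prop :=
  forall c, atlas c -> smooth_on (chart_cod c) (f \o chart_inv c).

Definition smooth_map (R : realType) (k n : nat) (S : manifold R k)
    (M : manifold R n) (j : S -> M) : Prop :=
  continuous j /\
  forall c d, atlas c -> atlas d ->
    smooth_on [set y | chart_cod c y /\ chart_dom d (j (chart_inv c y))]
      (chart_map d \o j \o chart_inv c).

Definition diff_fun (R : realType) (n m : nat) (M : manifold R n)
    (f : M -> 'rV[R]_m) (p : M) (v : 'rV[R]_n) : 'rV[R]_m :=
  'd (f \o chart_inv (chart_at p)) (chart_map (chart_at p) p) v.

Definition diff_map (R : realType) (k n : nat) (S : manifold R k)
    (M : manifold R n) (j : S -> M) (q : S) (w : 'rV[R]_k) : 'rV[R]_n :=
  'd (chart_map (chart_at (j q)) \o j \o chart_inv (chart_at q))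
     (chart_map (chart_at q) q) w.

Definition mink (R : realType) (n : nat) (X Y : 'rV[R]_n.+1) : R :=
  - (X 0 ord0 * Y 0 ord0) + \sum_(i < n) X 0 (lift ord0 i) * Y 0 (lift ord0 i).

Definition spacelike_hypersurface (R : realType) (n : nat) (M : manifold R n)
    (x : M -> 'rV[R]_n.+1) : Prop :=
  [/\ smooth_fun x,
      (forall p, injective (diff_fun x p)) &
      (forall p v, v != 0 -> 0 < mink (diff_fun x p v) (diff_fun x p v))].

Definition unit_normal (R : realType) (n : nat) (M : manifold R n)
    (x xi : M -> 'rV[R]_n.+1) : Prop :=
  [/\ smooth_fun xi,
      (forall p, mink (xi p) (xi p) = -1) &
      (forall p v, mink (xi p) (diff_fun x p v) = 0)].

(* The matrix [A], acting on row vectors, of the shape operator: it is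
   determined by [dx (A v) = - d xi v] (Weingarten), since [dx] is injective.
   It exists for a spacelike [x] with unit normal [xi]: see [shape_opP]. *)
Definition shape_op (R : realType) (n : nat) (M : manifold R n)
    (x xi : M -> 'rV[R]_n.+1) (p : M) : 'M[R]_n :=
  xget 0 [set A | forall v, diff_fun x p (v *m A) = - diff_fun xi p v].

Definition principal_curvature (R : realType) (n : nat) (M : manifold R n)
    (x xi : M -> 'rV[R]_n.+1) (p : M) (kappa : R) : Prop :=
  eigenvalue (shape_op x xi p) kappa.

(* The rows of this matrix span the principal space of [kappa] at [p]. *)
Definition principal_space (R : realType) (n : nat) (M : manifold R n)
    (x xi : M -> 'rV[R]_n.+1) (p : M) (kappa : R) : 'M[R]_n :=
  eigenspace (shape_op x xi p) kappa.

Definition tangent_to_principal_space (R : realType) (n k : nat)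
    (M : manifold R n) (x xi : M -> 'rV[R]_n.+1) (S : manifold R k)
    (j : S -> M) (q : S) (kappa : R) : Prop :=
  principal_curvature x xi (j q) kappa /\
  forall w : 'rV[R]_n,
    (exists v, diff_map j q v = w) <->
    (w <= principal_space x xi (j q) kappa)%MS.

(* Submanifolds are injectively immersed manifolds, such as the leaves of the
   foliation by curvature surfaces; this includes the embedded ones. *)
Definition curvature_surface (R : realType) (n k : nat) (M : manifold R n)
    (x xi : M -> 'rV[R]_n.+1) (S : manifold R k) (j : S -> M) : Prop :=
  [/\ connected [set: S],
      smooth_map j,
      injective j,
      (forall q, injective (diff_map j q)) &
      (forall q, exists kappa, tangent_to_principal_space x xi j q kappa)].

Definition dupin (R : realType) (n : nat) (M : manifold R n)
    (x xi : M -> 'rV[R]_n.+1) : Prop :=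
  forall (k : nat) (S : manifold R k) (j : S -> M),
    curvature_surface x xi j ->
    exists kappa, forall q, tangent_to_principal_space x xi j q kappa.

Definition num_principal_curvatures (R : realType) (n : nat)
    (M : manifold R n) (x xi : M -> 'rV[R]_n.+1) (p : M) (g : nat) : Prop :=
  exists s : seq R, [/\ uniq s, size s = g &
    forall kappa, kappa \in s <-> principal_curvature x xi p kappa].

Definition proper_dupin (R : realType) (n : nat) (M : manifold R n)
    (x xi : M -> 'rV[R]_n.+1) : Prop :=
  dupin x xi /\ exists g, forall p, num_principal_curvatures x xi p g.

Definition has_principal_multiplicities (R : realType) (n r : nat)
    (M : manifold R n) (x xi : M -> 'rV[R]_n.+1) (p : M)
    (v : 'I_r -> nat) : Prop :=
  exists lambda : 'I_r -> R,
    [/\ injective lambda,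
        (forall kappa, principal_curvature x xi p kappa <->
                       exists i, lambda i = kappa) &
        (forall i, \rank (principal_space x xi p (lambda i)) = v i)].

Lemma derive_minkxx (R : realType) (V : normedModType R) (n : nat)
    (f : V -> 'rV[R]_n.+1) (a v : V) : derivable f a v ->
  'D_v (fun y => mink (f y) (f y)) a = 2 * mink (f a) ('D_v f a).
Proof.
move=> df; have df' j : derivable (fun y => f y 0 j) a v.
  by move/derivable_mxP : df; apply.
pose g j : V -> R := fun y => f y 0 j.
have -> : (fun y => mink (f y) (f y)) =
    - (g ord0 * g ord0) + \sum_(i < n) g (lift ord0 i) * g (lift ord0 i).
  by apply/funext => y; rewrite /mink !fctE fct_sumE.
have dg j : is_derive a v (g j) ('D_v (g j) a) by apply/derivableP/df'.
rewrite derive_val /mink derive_mx// mxE mulrDr mulr_sumr -/(g ord0).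
congr (_ + _); first by rewrite -!scalerDl /g /GRing.scale/=; ring.
by apply: eq_bigr => i _; rewrite !mxE -!scalerDl /g /GRing.scale/=; ring.
Qed.

Lemma shape_opP (R : realType) (n : nat) (M : manifold R n)
    (x xi : M -> 'rV[R]_n.+1) (p : M) (v : 'rV[R]_n) :
    spacelike_hypersurface x -> unit_normal x xi ->
  diff_fun x p (v *m shape_op x xi p) = - diff_fun xi p v.
Proof.
move=> [_ injx _] [smxi xi1 xiN].
rewrite /shape_op; case: xgetP => [A _ ->//|]; suff [A PA] : [set A | forall v,
  diff_fun x p (v *m A) = - diff_fun xi p v] !=set0 by move=> /(_ A).
set c := chart_at p; set y0 := chart_map c p.
pose Jx := jacobian (x \o chart_inv c) y0.
pose Jxi := jacobian (xi \o chart_inv c) y0.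
have dxE w : diff_fun x p w = w *m Jx by rewrite mul_rV_lin1.
have dxiE w : diff_fun xi p w = w *m Jxi by rewrite mul_rV_lin1.
have y0c : chart_cod c y0 by apply/chart_map_cod/chart_at_dom.
have dxi : differentiable (xi \o chart_inv c) y0.
  by have [+ _] := smxi c (chart_at_atlas p) 1%N; apply.
have xi_tan w : mink (xi p) (diff_fun xi p w) = 0.
  rewrite /diff_fun -/c -/y0 -deriveE//.
  have := @derive_minkxx _ _ _ _ _ w (diff_derivable dxi).
  rewrite (_ : (fun y => _) = cst (-1 : R)); last first.
    by apply/funext => y /=; rewrite xi1.
  rewrite derive_cst /= /y0 chart_mapK; last exact: chart_at_dom.
  by move=> /esym/eqP; rewrite mulf_eq0 pnatr_eq0/= => /eqP.
pose B : 'cV[R]_n.+1 :=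
  \col_j (if j == ord0 then - xi p 0 j else xi p 0 j).
have minkE w : mink (xi p) w = (w *m B) 0 0.
  rewrite /mink mxE big_ord_recl !mxE eqxx mulrN mulrC; congr (_ + _).
  by apply: eq_bigr => i _; rewrite mxE/= mulrC.
have toB (J : 'M[R]_(n, n.+1)) :
    (forall w, mink (xi p) (w *m J) = 0) -> J *m B = 0.
  move=> J0; apply/row_matrixP => i; rewrite row_mul row0.
  by apply/matrixP => a b; rewrite !ord1 -minkE rowE J0 mxE.
have JxB : (Jx <= kermx B)%MS.
  by apply/sub_kermxP/toB => w; rewrite -dxE.
have JxiB : (Jxi <= kermx B)%MS.
  by apply/sub_kermxP/toB => w; rewrite -dxiE.
have B0 : B != 0.
  apply/eqP => B0; have := xi1 p; rewrite minkE B0 mulmx0 mxE => /eqP.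
  by rewrite eq_sym oppr_eq0 oner_eq0.
have rB : \rank (kermx B) = n.
  have rB1 : \rank B = 1%N.
    by apply/eqP; rewrite eqn_leq rank_leq_col lt0n mxrank_eq0 B0.
  by rewrite mxrank_ker rB1 subn1.
have rJx : \rank Jx = n.
  apply/eqP/inj_row_free => w; rewrite -dxE => dw0.
  by apply: (injx p); rewrite dw0 /diff_fun linear0.
have /submxP[D JxiE] : (Jxi <= Jx)%MS.
  apply: submx_trans JxiB _; have [_ <-] := mxrank_leqif_sup JxB.
  by rewrite rB rJx.
by exists (- D) => w; rewrite dxE dxiE JxiE mulmxN mulNmx mulmxA.
Qed.

(* Main.v *)
Require Import Defs.
From HB Require Import structures.
From mathcomp Require Import all_boot all_order all_algebra.
From mathcomp Require Import all_classical all_reals all_analysis.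
From mathcomp Require Import ring lra.
Set Implicit Arguments.
Unset Strict Implicit.
Unset Printing Implicit Defensive.
Import Order.TTheory GRing.Theory Num.Theory.
Import numFieldNormedType.Exports.
Local Open Scope classical_set_scope.
Local Open Scope ring_scope.

(** Parametrize hyperbolic spaces [H^k] by [Q_0 = e_0] and
    [Q_(k+1) = cosh y_k Q_k + sinh y_k e_(k+1)].  Take [xi = Q_n] as unit
    normal and [x = \sum_i Q_(e i)], where [e i] is the number of coordinates
    in the blocks [0, ..., i].  Truncating [v] to its first [k] coordinates and
    dividing by [\prod_(k <= l < n) cosh y_l] turns [dQ_n v] into [dQ_k v];
    hence [dx v = dxi (v D)] with [D] diagonal, equal on the block [i] to
    [radius i = \sum_(i' >= i) (\prod_(e i' <= l < n) cosh y_l)^-1].  So the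
    principal curvatures are the [- (radius i)^-1], pairwise distinct because
    [radius i] strictly decreases in [i], and constant along the block [i]
    because [radius i] involves only coordinates of later blocks.  Along a
    curvature surface the block index is locally constant by continuity of the
    differential, the coordinates outside of this block are then locally
    constant by the mean value theorem, and connectedness concludes. *)

(** * Row vectors as a manifold with one global chart *)

Lemma rV_second_countable (R : realType) (n : nat) :
  @second_countable 'rV[R]_n.
Proof.
pose box (q : {ffun 'I_n -> rat * rat}) : set 'rV[R]_n :=
  [set y | forall i, ratr (q i).1 < y 0 i < ratr (q i).2].
exists (range box).
  by apply: sub_countable (card_image_le _ _) (countableP _).
split=> [_ [q _ <-]|y U /nbhs_ballP[e /= e0 yeU]].
  rewrite openE => y qy.
  suff : nbhs y [set z : 'rV[R]_n |
    forall i, ratr (q i).1 < z 0 i < ratr (q i).2] by [].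
  have qyn i :
      nbhs y [set z : 'rV[R]_n | ratr (q i).1 < z 0 i < ratr (q i).2].
    have /andP[lt1 lt2] := qy i.
    have cy : (fun z : 'rV[R]_n => z 0 i) z @[z --> y] --> y 0 i.
      exact: coord_continuous.
    near=> z; apply/andP; split; near: z.
      exact: cvgr_gt _ cy _ lt1.
    exact: cvgr_lt _ cy _ lt2.
  exact: filter_forall qyn.
(* Balls of row vectors are coordinatewise, so rational endpoints within [e] of each coordinate keep
   the box inside the ball. *)
have qex i : exists q : rat * rat,
    y 0 i - e < ratr q.1 < y 0 i /\ y 0 i < ratr q.2 < y 0 i + e.
  have [|a] := @rat_in_itvoo _ (y 0 i - e) (y 0 i); first by rewrite gtrBl.
  have [|b] := @rat_in_itvoo _ (y 0 i) (y 0 i + e); first by rewrite ltrDl.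
  by rewrite !in_itv /= => ? ?; exists (a, b).
have [q qP] := choice qex; pose q' := [ffun i => q i].
have qy : box q' y.
  by move=> i; rewrite ffunE; have [/andP[_ ->] /andP[->]] := qP i.
exists (box q') => [|z zq]; first by split=> //; exists q'.
apply: yeU; split=> // a i; rewrite ord1.
have [/andP[h1 h2] /andP[h3 h4]] := qP i; have := zq i.
rewrite ffunE => /andP[h5 h6]; rewrite /ball /= ltr_norml; lra.
Unshelve. all: by end_near. Qed.

(** Transparent, so that chart maps reduce to the identity and differentials in the chart become
    ordinary ones. *)
Definition rV_chart (R : realType) (n : nat) : chart R 'rV[R]_n n.
Proof.
by refine (@Chart R 'rV[R]_n n setT setT id id openT openT _ _ _ _ _ _)
  => // p _; exact: cvg_id.
Defined.

(** The identity is the transition map of the one-chart atlas. Its directional derivatives are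
    constant, so the induction runs on constants. *)
Lemma Ck_on_id (R : realType) (V : normedModType R) (k : nat) (U : set V) :
  Ck_on k U (@id V).
Proof.
have cst_Ck j (w : V) : Ck_on j U (fun=> w).
  elim: j w => [|j IH] w /=; first by move=> y _; exact: cvg_cst.
  split=> [y _|v]; first exact: differentiable_cst.
  have -> : (fun y : V => 'D_v (fun=> w) y) = fun=> 0; last exact: IH.
  by apply/funext => y; exact: (derive_cst w).
case: k => [|k] /=; first by move=> y _; exact: cvg_id.
split=> [y _|v]; first by apply: ex_diff; apply: is_diff_id.
have -> : (fun y : V => 'D_v (@id V) y) = fun=> v; last exact: cst_Ck.
by apply/funext => y; exact: derive_id.
Qed.

Definition rV_manifold (R : realType) (n : nat) : manifold R n.
Proof.
refine (@Manifold R n 'rV[R]_n (@norm_hausdorff _ _)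
  (@rV_second_countable R n) [set rV_chart R n] (fun=> rV_chart R n) _ _ _).
- by [].
- by [].
- by move=> c d -> -> k; exact: Ck_on_id.
Defined.

(** * Smoothness of finite sums of exponentials of linear forms *)

Inductive exp_sum (R : realType) (n : nat) (W : normedModType R) :
    ('rV[R]_n -> W) -> Prop :=
| exp_sum0 : exp_sum (fun=> 0)
| exp_sum_cons (a : 'rV[R]_n) (w : W) (f : 'rV[R]_n -> W) : exp_sum f ->
    exp_sum (fun y => expR (\sum_i a 0 i * y 0 i) *: w + f y).

Section ExpSum.
Context (R : realType) (n : nat).
Local Notation V := 'rV[R]_n.

Lemma is_derive_coord (i : 'I_n) (y v : V) :
  is_derive y v (fun z : V => z 0 i) (v 0 i).
Proof.
apply: DeriveDef; first exact/diff_derivable/differentiable_coord.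
have := @derive_mx _ _ _ _ (@id V) y v.
rewrite derive_id => /(_ (@derivable_id _ _ _ _)) /matrixP/(_ 0 i).
by rewrite mxE.
Qed.

Lemma differentiable_linear_form (a y : V) :
  differentiable (fun z : V => \sum_i a 0 i * z 0 i) y.
Proof.
rewrite (_ : (fun z => _) = \sum_i (a 0 i *: (fun z : V => z 0 i))).
  by apply: differentiable_sum => i; exact/differentiableZ/differentiable_coord.
by apply/funext => z; rewrite fct_sumE.
Qed.

Lemma is_derive_linear_form (a y v : V) :
  is_derive y v (fun z : V => \sum_i a 0 i * z 0 i) (\sum_i a 0 i * v 0 i).
Proof.
rewrite (_ : (fun z => _) = \sum_i (a 0 i *: (fun z : V => z 0 i))).
  apply: is_derive_sum => i; apply: is_deriveZ; exact: is_derive_coord.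
by apply/funext => z; rewrite fct_sumE.
Qed.

Lemma differentiable_expR (x : R) : differentiable (@expR R) x.
Proof. exact/derivable1_diffP. Qed.

Lemma differentiable_exp_form (a y : V) :
  differentiable (fun z : V => expR (\sum_i a 0 i * z 0 i)) y.
Proof.
apply: (@differentiable_comp _ _ _ _ _ (@expR R)).
  exact: differentiable_linear_form.
exact: differentiable_expR.
Qed.

Lemma derive_exp_form (a y v : V) :
  'D_v (fun z : V => expR (\sum_i a 0 i * z 0 i)) y =
  expR (\sum_i a 0 i * y 0 i) * (\sum_i a 0 i * v 0 i).
Proof.
rewrite deriveE; last exact: differentiable_exp_form.
rewrite (@diff_comp _ _ _ _ _ (@expR R)) /=; last first.
- exact: differentiable_expR.
- exact: differentiable_linear_form.
rewrite -(deriveE v); last exact: differentiable_linear_form.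
have [_ ->] := is_derive_linear_form a y v.
rewrite -(deriveE (_ : R)); last exact: differentiable_expR.
set h := \sum_i a 0 i * v 0 i; rewrite -[h in 'D_h _ _]mulr1.
rewrite (_ : h * 1 = h *: 1) // deriveE; last exact: differentiable_expR.
rewrite linearZ -deriveE; last exact: differentiable_expR.
by rewrite derive_val /GRing.scale /= mulrC.
Qed.

Context (W : normedModType R).
Implicit Types f g : V -> W.

Lemma exp_sum_differentiable f y : exp_sum f -> differentiable f y.
Proof.
elim=> [|a w {}f _ IH]; first exact: differentiable_cst.
apply: differentiableD IH.
exact/differentiableZl/differentiable_exp_form.
Qed.

Lemma exp_sumD f g : exp_sum f -> exp_sum g -> exp_sum (fun y => f y + g y).
Proof.
move=> ef eg; elim: ef => [|a w {}f _ IH].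
  by under eq_fun do rewrite add0r.
by under eq_fun do rewrite -addrA; exact: exp_sum_cons.
Qed.

Lemma exp_sum_sum r (f : 'I_r -> V -> W) : (forall i, exp_sum (f i)) ->
  exp_sum (fun y => \sum_i f i y).
Proof.
move=> ef; have -> : (fun y => \sum_i f i y) = \sum_i f i.
  by apply/funext => y; rewrite fct_sumE.
apply: (big_ind (@exp_sum R n W)) => //; first exact: exp_sum0.
exact: exp_sumD.
Qed.

(** Exponents add under multiplication. This closure covers products with hyperbolic cosines and
    sines of coordinates. *)
Lemma exp_sum_scale (a : V) (c : R) f : exp_sum f ->
  exp_sum (fun y : V => (c * expR (\sum_i a 0 i * y 0 i)) *: f y).
Proof.
elim=> [|b w {}f _ IH].
  by under eq_fun do rewrite scaler0; exact: exp_sum0.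
rewrite (_ : (fun y => _) = fun y : V =>
   expR (\sum_i (a + b) 0 i * y 0 i) *: (c *: w) +
   (c * expR (\sum_i a 0 i * y 0 i)) *: f y); first exact: exp_sum_cons.
apply/funext => y; rewrite scalerDr !scalerA; congr (_ *: _ + _).
rewrite -mulrA -expRD mulrC -big_split/=; congr (expR _ * _).
by apply: eq_bigr => i _; rewrite mxE mulrDl.
Qed.

Lemma exp_sum_cst (w : W) : exp_sum (fun _ : V => w).
Proof.
rewrite (_ : (fun _ => w) =
  fun y : V => expR (\sum_i (0 : V) 0 i * y 0 i) *: w + 0).
  exact/exp_sum_cons/exp_sum0.
by apply/funext => y; rewrite big1 ?expR0 ?scale1r ?addr0// => i _;
   rewrite mxE mul0r.
Qed.

(** Differentiating a term only multiplies its coefficient [w] by [\sum_i a 0 i * v 0 i]. This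
    closure gives smoothness by induction on the order. *)
Lemma exp_sum_derive f v : exp_sum f -> exp_sum (fun y => 'D_v f y).
Proof.
elim=> [|a w {}f ef IH].
  have -> : (fun y : V => 'D_v (fun=> 0 : W) y) = fun=> 0.
    by apply/funext => y; exact: (derive_cst (0 : W)).
  exact: exp_sum0.
suff -> : (fun y => 'D_v (fun z : V => expR (\sum_i a 0 i * z 0 i) *: w + f z) y) =
    fun y : V => expR (\sum_i a 0 i * y 0 i) *: ((\sum_i a 0 i * v 0 i) *: w) +
             'D_v f y by exact: exp_sum_cons.
apply/funext => y; rewrite deriveD; last 2 first.
- exact/diff_derivable/differentiableZl/differentiable_exp_form.
- exact/diff_derivable/exp_sum_differentiable.
congr (_ + _); have de := differentiable_exp_form a y.
rewrite deriveE; last exact: differentiableZl.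
by rewrite diffZl// -deriveE// derive_exp_form scalerA.
Qed.

Lemma exp_sum_smooth f U : exp_sum f -> smooth_on U f.
Proof.
move=> ef k; elim: k f ef => [|k IH] f ef /=.
  by move=> y _; exact/differentiable_continuous/exp_sum_differentiable.
split=> [y _|v]; first exact: exp_sum_differentiable.
exact/IH/exp_sum_derive.
Qed.

End ExpSum.

(** * Diagonal matrices that are scalar on each block *)

Lemma rV_diagE (F : fieldType) (n : nat) (d w : 'rV[F]_n) :
  w *m diag_mx d = \row_j (w 0 j * d 0 j).
Proof. by rewrite mul_mx_diag; apply/rowP => j; rewrite !mxE. Qed.

Section BlockDiagonal.
Context (F : fieldType) (n r : nat) (beta : 'I_n -> 'I_r) (kap : 'I_r -> F).
Hypothesis kap_inj : injective kap.
Local Notation D := (diag_mx (\row_j kap (beta j))).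

(** Coordinate [l] of the eigenvector equation is [(kap (beta l) - kap i) * w 0 l = 0], whose first
    factor vanishes only on the block [i]. *)
Lemma sub_eigenspace_blockP (i : 'I_r) (w : 'rV_n) :
  (w <= eigenspace D (kap i))%MS <->
  forall l, beta l != i -> w 0 l = 0.
Proof.
split=> [/eigenspaceP|w0].
  rewrite rV_diagE => /rowP wE l bl; move: (wE l); rewrite !mxE mulrC => /eqP.
  rewrite -subr_eq0 -mulrBl mulf_eq0 subr_eq0 (inj_eq kap_inj).
  by rewrite (negbTE bl) => /eqP.
apply/eigenspaceP; rewrite rV_diagE; apply/rowP => l; rewrite !mxE mulrC.
have [->//|/w0->] := eqVneq (beta l) i.
by rewrite !mulr0.
Qed.

Lemma eigenvalue_blockP (a : F) : (forall i, exists l, beta l = i) ->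
  eigenvalue D a <-> exists i, kap i = a.
Proof.
move=> beta_surj; split=> [/eigenvalueP[w]|[i <-]].
  rewrite rV_diagE => /rowP wE /rV0Pn[l wl0]; exists (beta l).
  by apply: (mulIf wl0); have := wE l; rewrite !mxE mulrC.
have [l bl] := beta_surj i; apply/eigenvalueP; exists (delta_mx 0 l).
  apply/eigenspaceP/sub_eigenspace_blockP => l'; rewrite -bl !mxE eqxx /=.
  by have [->|//] := eqVneq l' l; rewrite eqxx.
by apply/rV0Pn; exists l; rewrite mxE !eqxx oner_neq0.
Qed.

(** The basis vectors of the block, enumerated by [f], form a matrix [B] with [B *m B^T = 1]; its
    [m] rows are thus free, and they span the eigenspace. *)
Lemma rank_eigenspace_block (i : 'I_r) (m : nat) (f : 'I_m -> 'I_n) :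
  injective f -> (forall l, beta l = i <-> exists k, f k = l) ->
  \rank (eigenspace D (kap i)) = m.
Proof.
move=> f_inj fP; pose B : 'M[F]_(m, n) := \matrix_(k, l) (f k == l)%:R.
have BBT : B *m B^T = 1%:M.
  apply/matrixP => a b; rewrite !mxE (bigD1 (f a))//= !mxE eqxx mul1r.
  rewrite big1 ?addr0 => [|l]; first by rewrite (inj_eq f_inj) eq_sym.
  by rewrite !mxE eq_sym => /negbTE ->; rewrite mul0r.
have Bfree : row_free B by apply/row_freeP; exists B^T.
rewrite -[RHS](eqP Bfree); apply/eqmx_rank/andP; split; last first.
  apply/row_subP => k; apply/sub_eigenspace_blockP => l /eqP bl.
  by rewrite !mxE; case: eqP => // fkl; case: bl; apply/fP; exists k.
apply/row_subP => k; move: (row k _) (row_sub k (eigenspace D (kap i))) => w.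
move/sub_eigenspace_blockP => w0.
apply/submxP; exists (\row_a w 0 (f a)); apply/rowP => l; rewrite !mxE.
have [/fP[a fa]|bl] := eqVneq (beta l) i.
  rewrite (bigD1 a)//= !mxE fa eqxx mulr1 big1 ?addr0// => b ba.
  by rewrite !mxE -fa (inj_eq f_inj) (negbTE ba) mulr0.
rewrite w0// big1 // => a _; rewrite !mxE.
have [fa|] := eqP; last by rewrite mulr0.
by move/eqP: bl; case; apply/fP; exists a.
Qed.

End BlockDiagonal.

(** * From local to global constancy *)

Lemma connected_locally_constant (T : topologicalType) (U : Type) (f : T -> U) :
  connected [set: T] -> (forall x, nbhs x [set y | f y = f x]) ->
  forall x y, f x = f y.
Proof.
(* The fibre through [x] is nonempty, open and closed. *)
move=> cT lf x y; suff : [set z | f z = f x] = setT.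
  by move=> /seteqP[_ /(_ y I) /= ->].
apply: cT; first by exists x.
- exists [set z | f z = f x]; last by rewrite setTI.
  by rewrite openE => z /= <-; exact: lf.
- exists [set z | f z = f x]; last by rewrite setTI.
  rewrite -openC openE => z /= fz; apply: filterS (lf z) => t /= ->.
  exact: fz.
Qed.

(** The segment from [y] to [z] stays in the ball, and the mean value theorem applies to the single
    scalar function obtained from coordinate [l] along it. *)
Lemma cst_coord_on_ball (R : realType) (k n : nat) (F : 'rV[R]_k -> 'rV[R]_n)
    (y : 'rV[R]_k) (e : R) (l : 'I_n) :
  (forall z, ball y e z -> differentiable F z) ->
  (forall z w, ball y e z -> ('D_w F z) 0 l = 0) ->
  forall z, ball y e z -> F z 0 l = F y 0 l.
Proof.
move=> dF DF0 z; rewrite -ball_normE /= => yz.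
pose p (t : R) := y + t *: (z - y).
have pin (t : R) : 0 <= t <= 1 -> ball y e (p t).
  move=> /andP[t0 t1]; rewrite -ball_normE /= /p opprD addNKr normrN normrZ.
  rewrite distrC in yz; apply: le_lt_trans yz.
  by rewrite ger0_norm// ler_piMl.
have dp (t : R) : differentiable p t.
  by apply: differentiableD; [exact: differentiable_cst|
    apply: (@differentiableZl _ _ _ (@id R))].
have dg (t : R) : 0 <= t <= 1 -> differentiable (F \o p) t.
  by move=> t01; apply: differentiable_comp => //; apply/dF/pin.
have dgl (t : R) : 0 <= t <= 1 -> differentiable (fun s : R => F (p s) 0 l) t.
  move=> t01.
  apply: (@differentiable_comp _ _ _ _ (F \o p) (fun N : 'rV[R]_n => N 0 l)).
    exact: dg.
  exact: differentiable_coord.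
have [||c] := @MVT R (fun t => F (p t) 0 l) (fun=> 0) 0 1 ltr01.
- move=> t; rewrite in_itv /= => /andP[t0 t1].
  have t01 : 0 <= t <= 1 by rewrite !ltW.
  apply: DeriveDef; first exact/diff_derivable/dgl.
  have gd : derivable (F \o p) t 1 by exact/diff_derivable/dg.
  transitivity (('D_1 (F \o p) t) 0 l); first by rewrite derive_mx// mxE.
  rewrite deriveE; last exact: dg.
  rewrite diff_comp//=; last exact/dF/pin.
  by rewrite -deriveE ?DF0//; [exact: pin|exact/dF/pin].
- apply/continuous_within_itvP => //.
  have ct (t : R) : 0 <= t <= 1 -> {for t, continuous (fun t : R => F (p t) 0 l)}.
    by move=> /dgl /differentiable_continuous.
  split.
  + by move=> t; rewrite in_itv /= => /andP[t0 t1]; apply: ct; rewrite !ltW.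
  + by apply: cvg_at_right_filter; apply: ct; rewrite lexx ler01.
  + by apply: cvg_at_left_filter; apply: ct; rewrite lexx ler01.
rewrite mul0r => _ /eqP; rewrite subr_eq0 /p scale1r scale0r addr0.
by rewrite subrKC => /eqP.
Qed.

(** * Smooth maps into row vectors, read in charts of the source *)

Section CurvatureSurface.
Context (R : realType) (n k : nat) (S : manifold R k).
Variable j : S -> rV_manifold R n.
Hypothesis j_smooth : smooth_map j.

Let F (c : chart R S k) : 'rV[R]_k -> 'rV[R]_n := j \o chart_inv c.

Lemma smooth_map_rV (c : chart R S k) : atlas c -> smooth_on (chart_cod c) (F c).
Proof.
move=> ac; have [_ /(_ c (rV_chart R n) ac erefl)] := j_smooth.
by rewrite (_ : [set y | _] = chart_cod c)//; apply/seteqP; split=> [y []|].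
Qed.

(** [diff_map] uses a preferred chart that varies with the point, whereas continuity of the
    derivative needs a fixed chart [c]. The chain rule through the transition map [tau] compares the
    two. *)
Lemma derive_chart_diff_map (c : chart R S k) (y w : 'rV[R]_k) :
  atlas c -> chart_cod c y ->
  exists w', 'D_w (F c) y = diff_map j (chart_inv c y) w'.
Proof.
move=> ac cy; set q := chart_inv c y; set c' := chart_at q.
have qc : chart_dom c q by exact: chart_inv_dom.
have qc' : chart_dom c' q by exact: chart_at_dom.
pose tau := chart_map c' \o chart_inv c.
have dtau : differentiable tau y.
  have [+ _] := atlas_compatible ac (chart_at_atlas q) 1%N.
  by apply; split.
have tauy : tau y = chart_map c' q by [].
have dF' : differentiable (F c') (tau y).
  have [+ _] := smooth_map_rV (chart_at_atlas q) 1%N.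
  by apply; rewrite tauy; exact: chart_map_cod.
exists ('d tau y w); rewrite (near_eq_derive (g := F c' \o tau)).
  rewrite deriveE; last exact: differentiable_comp.
  by rewrite diff_comp.
have ci := chart_inv_continuous cy.
(* The factorization through [c'] holds only where [chart_inv c] lands in its domain, a
   neighbourhood of [y]. *)
have nd : nbhs y [set z | chart_dom c' (chart_inv c z)].
  by apply: ci; apply: open_nbhs_nbhs; split=> //; exact: chart_dom_open.
apply: filterS nd => z /= zc'.
by rewrite /F/= /tau/= chart_mapK.
Qed.

End CurvatureSurface.

(** * The Dupin property for a block-diagonal shape operator *)

Section BlockDupin.
Context (R : realType) (n r : nat) (beta : 'I_n -> 'I_r).
Context (x xi : rV_manifold R n -> 'rV[R]_n.+1).
Context (kap : 'I_r -> 'rV[R]_n -> R).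
Hypothesis beta_surj : forall i, exists l, beta l = i.
Hypothesis shape_diag : forall p,
  shape_op x xi p = diag_mx (\row_l kap (beta l) p).
Hypothesis kap_inj : forall p, injective (kap ^~ p).
Hypothesis kap_indep : forall i (p q : 'rV[R]_n),
  (forall l, beta l != i -> p 0 l = q 0 l) -> kap i p = kap i q.

Lemma block_dupin : dupin x xi.
Proof.
move=> k S j [conS sj injj injdj tanj].
have tan_kap q : exists i, tangent_to_principal_space x xi j q (kap i (j q)).
  have [a [pa spa]] := tanj q.
  have [i ia] : exists i, kap i (j q) = a.
    move: pa; rewrite /principal_curvature shape_diag.
    by move/(@eigenvalue_blockP _ _ _ _ (kap ^~ (j q)) (@kap_inj _) _ beta_surj).
  by exists i; rewrite ia.
have [idx idxP] := choice tan_kap.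
have spE q w : (exists v, diff_map j q v = w) <->
    forall l, beta l != idx q -> w 0 l = 0.
  have [_ /(_ w) spq] := idxP q; rewrite spq /principal_space shape_diag.
  exact: (sub_eigenspace_blockP _ (@kap_inj (j q))).
suff lc q0 : nbhs q0 [set q | kap (idx q) (j q) = kap (idx q0) (j q0)].
  (* On an empty [S] any value serves; [0] is taken. *)
  have [[q0 _]|S0] := pselect ([set: S] !=set0); last first.
    by exists 0 => q; exfalso; apply: S0; exists q.
  exists (kap (idx q0) (j q0)) => q.
  by rewrite (connected_locally_constant conS lc q0 q).
set c := chart_at q0; set y0 := chart_map c q0.
have ac : atlas c by exact: chart_at_atlas.
have q0c : chart_dom c q0 by exact: chart_at_dom.
have y0c : chart_cod c y0 by exact: chart_map_cod.
have invy0 : chart_inv c y0 = q0 by rewrite chart_mapK.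
pose F : 'rV[R]_k -> 'rV[R]_n := j \o chart_inv c.
have [dF CF] := smooth_map_rV sj ac 1%N.
have DF y w l : chart_cod c y -> beta l != idx (chart_inv c y) ->
    ('D_w F y) 0 l = 0.
  move=> yc bl; have [w' ->] := derive_chart_diff_map sj w ac yc.
  by apply: (spE _ _).1 bl; exists w'.
have [l0 bl0] := beta_surj (idx q0).
(* The tangent space fills the whole principal space, so it contains a basis vector of the block
   [idx q0]. *)
have [w w1] : exists w, 'D_w F y0 = delta_mx 0 l0.
  have [|w wE] := (spE q0 (delta_mx 0 l0)).2.
    by move=> l; rewrite -bl0 mxE eqxx /=; have [->|//] := eqVneq l l0;
       rewrite eqxx.
  by exists w; rewrite deriveE; [exact: wE|exact: dF].
(* Coordinate [l0] of ['D_w F] is [1] at [y0], hence positive nearby; another block index at [y]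
   would force it to be [0] there. *)
have idx_near : nbhs y0 [set y | chart_cod c y /\ idx (chart_inv c y) = idx q0].
  have cl0 : (fun y => ('D_w F y) 0 l0) y @[y --> y0] --> (1 : R).
    have -> : (1 : R) = ('D_w F y0) 0 l0 by rewrite w1 mxE !eqxx.
    apply: (@continuous_comp _ _ _ (fun y => 'D_w F y)
      (fun N : 'rV[R]_n => N 0 l0)); first exact: CF.
    exact: coord_continuous.
  have nc : nbhs y0 (chart_cod c).
    by apply: open_nbhs_nbhs; split=> //; exact: chart_cod_open.
  have gt0 : nbhs y0 [set y | 0 < ('D_w F y) 0 l0].
    exact: (cvgr_gt _ cl0 _ ltr01).
  apply: filterS2 nc gt0 => y yc /= Dy; split=> //.
  apply/eqP; rewrite -bl0 eq_sym; apply: contraTT Dy => bl.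
  by rewrite DF// ltxx.
have /nbhs_ballP[e /= e0 ye] := idx_near.
have nq : nbhs q0 [set q | chart_dom c q /\ ball y0 e (chart_map c q)].
  apply: filterI.
    by apply: open_nbhs_nbhs; split=> //; exact: chart_dom_open.
  by apply: (chart_map_continuous q0c); exact: nbhsx_ballx.
apply: filterS nq => q [qc yq] /=.
have [_ idxq] := ye _ yq; rewrite chart_mapK// in idxq; rewrite idxq.
(* It remains to see that the coordinates outside the block [idx q0] are constant on the ball, where
   [DF] kills their derivatives. *)
apply: kap_indep => l bl.
have := @cst_coord_on_ball R k n F y0 e l _ _ _ yq.
rewrite /F /= !chart_mapK//; apply.
- by move=> z /ye[zc _]; exact: dF.
- by move=> z u /ye[zc iz]; apply: DF => //; rewrite iz.
Qed.

Lemma block_num_principal_curvatures p :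
  num_principal_curvatures x xi p r.
Proof.
exists [seq kap i p | i : 'I_r]; split.
- by rewrite map_inj_uniq ?enum_uniq//; exact: kap_inj.
- by rewrite size_map size_enum_ord.
move=> a; rewrite /principal_curvature shape_diag.
rewrite (@eigenvalue_blockP _ _ _ _ (kap ^~ p) (@kap_inj _) _ beta_surj).
split=> [/mapP[i _ ->]|[i <-]]; first by exists i.
by apply: map_f; rewrite mem_enum.
Qed.

Lemma block_multiplicities (v : 'I_r -> nat) (f : forall i, 'I_(v i) -> 'I_n) :
  (forall i, injective (f i)) ->
  (forall i l, beta l = i <-> exists k, f i k = l) ->
  forall p, has_principal_multiplicities x xi p v.
Proof.
move=> f_inj fP p; exists (kap ^~ p); split; first exact: kap_inj.
  move=> a; rewrite /principal_curvature shape_diag.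
  exact: (@eigenvalue_blockP _ _ _ _ (kap ^~ p) (@kap_inj _) _ beta_surj).
move=> i; rewrite /principal_space shape_diag.
exact: (rank_eigenspace_block (@kap_inj p) (f_inj i) (fP i)).
Qed.

End BlockDupin.

(** * Bilinearity of the Minkowski form *)

Section Minkowski.
Context (R : realType) (n : nat).
Implicit Types X Y Z : 'rV[R]_n.+1.

Lemma minkC X Y : mink X Y = mink Y X.
Proof.
rewrite /mink mulrC; congr (_ + _); apply: eq_bigr => i _; exact: mulrC.
Qed.

Lemma minkDl X Y Z : mink (X + Y) Z = mink X Z + mink Y Z.
Proof.
rewrite /mink !mxE mulrDl opprD addrACA -big_split /=.
by congr (_ + _); apply: eq_bigr => i _; rewrite mxE mulrDl.
Qed.

Lemma minkZl a X Y : mink (a *: X) Y = a * mink X Y.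
Proof.
rewrite /mink !mxE mulrDr mulrN mulrA mulr_sumr.
by congr (_ + _); apply: eq_bigr => i _; rewrite mxE mulrA.
Qed.

Lemma minkDr X Y Z : mink X (Y + Z) = mink X Y + mink X Z.
Proof. by rewrite minkC minkDl !(minkC X). Qed.

Lemma minkZr a X Y : mink X (a *: Y) = a * mink X Y.
Proof. by rewrite minkC minkZl minkC. Qed.

Lemma mink0r X : mink X 0 = 0.
Proof. by rewrite -(scale0r X) minkZr mul0r. Qed.

End Minkowski.

(** The index is a natural number, to suit recursion on the dimension; the row is zero when
    [k >= n]. *)
Definition unit_row (R : realType) (n k : nat) : 'rV[R]_n :=
  \row_i (i == k :> nat)%:R.

Lemma mink_unit_row (R : realType) (n : nat) (X : 'rV[R]_n.+1) (i : 'I_n) :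
  mink X (unit_row R n.+1 i.+1) = X 0 (lift ord0 i).
Proof.
rewrite /mink !mxE mulr0 oppr0 add0r (bigD1 i)//= !mxE eqxx mulr1.
rewrite big1 ?addr0// => l li; rewrite mxE /= eqSS.
by rewrite (inj_eq val_inj) (negbTE li) mulr0.
Qed.

(** * The recursive parametrization of hyperbolic spaces and its metric *)

Section Spheres.
Context (R : realType) (n : nat).
Local Notation V := 'rV[R]_n.
Implicit Types (y v w : V) (k : nat).

(* The coordinate [y 0 k], extended by [0] for [k >= n]. *)
Definition crd y k : R := \sum_i unit_row R n k 0 i * y 0 i.

Definition ch (t : R) : R := (expR t + expR (- t)) / 2.
Definition sh (t : R) : R := (expR t - expR (- t)) / 2.

Fixpoint hyp k y : 'rV[R]_n.+1 :=
  if k is l.+1 then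
    ch (crd y l) *: hyp l y + sh (crd y l) *: unit_row R n.+1 l.+1
  else unit_row R n.+1 0.

(** The product rule applied to the recursion of [hyp], kept as an explicit formula for algebraic
    inductions; [derive_hyp] identifies it with the derivative. *)
Fixpoint dhyp k y v : 'rV[R]_n.+1 :=
  if k is l.+1 then
    ch (crd y l) *: dhyp l y v +
    crd v l *: (sh (crd y l) *: hyp l y + ch (crd y l) *: unit_row R n.+1 l.+1)
  else 0.

Lemma crdE y (i : 'I_n) : crd y i = y 0 i.
Proof.
rewrite /crd (bigD1 i)//= mxE eqxx mul1r big1 ?addr0// => l li.
by rewrite mxE (inj_eq val_inj) (negbTE li) mul0r.
Qed.

Lemma ch_gt0 t : 0 < ch t.
Proof. by rewrite divr_gt0// addr_gt0// expR_gt0. Qed.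

Lemma ch2Bsh2 t : ch t ^+ 2 - sh t ^+ 2 = 1.
Proof.
have e : expR t * expR (- t) = 1 by rewrite -expRD subrr expR0.
by rewrite /ch /sh -[RHS]e; field.
Qed.

Lemma crdN y k : - crd y k = \sum_i (- unit_row R n k) 0 i * y 0 i.
Proof. by rewrite /crd -sumrN; apply: eq_bigr => i _; rewrite !mxE mulNr. Qed.

Lemma exp_sum_hyp k : exp_sum (hyp k).
Proof.
elim: k => [|k IH] /=; first exact: exp_sum_cst.
have eN (f : V -> 'rV[R]_n.+1) c : exp_sum f ->
    exp_sum (fun y => (c * expR (- crd y k)) *: f y).
  by move=> ef; under eq_fun do rewrite crdN; exact: exp_sum_scale.
apply: exp_sumD; rewrite /ch /sh.
  under eq_fun do rewrite mulrC mulrDr scalerDl.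
  by apply: exp_sumD; [exact: exp_sum_scale|exact: eN].
under eq_fun do rewrite mulrC mulrBr -mulNr scalerDl.
apply: exp_sumD; first exact/exp_sum_scale/exp_sum_cst.
exact/eN/exp_sum_cst.
Qed.

Lemma differentiable_hyp k y : differentiable (hyp k) y.
Proof. exact/exp_sum_differentiable/exp_sum_hyp. Qed.

Lemma is_derive_exp_crd y v k :
  is_derive y v (fun z => expR (crd z k)) (expR (crd y k) * crd v k).
Proof.
apply: DeriveDef; last exact: derive_exp_form.
exact/diff_derivable/differentiable_exp_form.
Qed.

Lemma is_derive_exp_Ncrd y v k :
  is_derive y v (fun z => expR (- crd z k)) (- (expR (- crd y k) * crd v k)).
Proof.
under eq_fun do rewrite crdN.
apply: DeriveDef; first exact/diff_derivable/differentiable_exp_form.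
by rewrite derive_exp_form -!crdN mulrN.
Qed.

Lemma is_derive_ch y v k :
  is_derive y v (fun z => ch (crd z k)) (sh (crd y k) * crd v k).
Proof.
rewrite (_ : (fun z => _) = 2^-1 *: ((fun z : V => expR (crd z k)) +
  (fun z : V => expR (- crd z k)))); last first.
  by apply/funext => z; rewrite /ch mulrC.
have de := is_derive_exp_crd y v k; have dN := is_derive_exp_Ncrd y v k.
by apply: is_derive_eq; rewrite /GRing.scale /= /sh; ring.
Qed.

Lemma is_derive_sh y v k :
  is_derive y v (fun z => sh (crd z k)) (ch (crd y k) * crd v k).
Proof.
rewrite (_ : (fun z => _) = 2^-1 *: ((fun z : V => expR (crd z k)) -
  (fun z : V => expR (- crd z k)))); last first.
  by apply/funext => z; rewrite /sh mulrC.
have de := is_derive_exp_crd y v k; have dN := is_derive_exp_Ncrd y v k.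
by apply: is_derive_eq; rewrite /GRing.scale /= /ch; ring.
Qed.

Lemma is_derive_hyp_coord k y v (i : 'I_n.+1) :
  is_derive y v (fun z => hyp k z 0 i) (dhyp k y v 0 i).
Proof.
elim: k => [|k IH] /=; first by rewrite !mxE; exact: is_derive_cst.
have dc := is_derive_ch y v k; have ds := is_derive_sh y v k.
pose c : R := unit_row R n.+1 k.+1 0 i.
rewrite (_ : (fun z => _) =
  (fun z : V => ch (crd z k)) * (fun z : V => hyp k z 0 i) +
  c *: (fun z : V => sh (crd z k))); last first.
  by apply/funext => z; rewrite !mxE /c mxE [sh _ * _]mulrC.
by apply: is_derive_eq; rewrite /GRing.scale /= !mxE /c mxE; ring.
Qed.

Lemma derive_hyp k y v : 'D_v (hyp k) y = dhyp k y v.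
Proof.
rewrite derive_mx; last exact/diff_derivable/differentiable_hyp.
apply/rowP => i; rewrite mxE; have [_ ->] := is_derive_hyp_coord k y v i.
by [].
Qed.

Lemma diff_hyp k y v : 'd (hyp k) y v = dhyp k y v.
Proof. by rewrite -deriveE ?derive_hyp//; exact: differentiable_hyp. Qed.

(** Makes the basis vector added at each stage orthogonal to everything built before. *)
Lemma hyp_above k y (i : 'I_n.+1) : (k < i)%N -> hyp k y 0 i = 0.
Proof.
elim: k => [|k IH] ki /=; rewrite !mxE; first by rewrite gtn_eqF.
by rewrite (IH (ltnW ki)) (gtn_eqF ki) !mulr0 addr0.
Qed.

Lemma dhyp_above k y v (i : 'I_n.+1) : (k < i)%N -> dhyp k y v 0 i = 0.
Proof.
elim: k => [|k IH] ki /=; rewrite !mxE//.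
by rewrite (IH (ltnW ki)) (hyp_above _ (ltnW ki)) (gtn_eqF ki) !(mulr0, addr0).
Qed.

Lemma mink_unit_row1 k : (k < n)%N ->
  mink (unit_row R n.+1 k.+1) (unit_row R n.+1 k.+1) = 1.
Proof. by move=> kn; rewrite (mink_unit_row _ (Ordinal kn)) mxE /= eqxx. Qed.

Lemma mink_hyp_unit k y : (k < n)%N -> mink (hyp k y) (unit_row R n.+1 k.+1) = 0.
Proof. by move=> kn; rewrite (mink_unit_row _ (Ordinal kn)) hyp_above. Qed.

Lemma mink_dhyp_unit k y v : (k < n)%N ->
  mink (dhyp k y v) (unit_row R n.+1 k.+1) = 0.
Proof. by move=> kn; rewrite (mink_unit_row _ (Ordinal kn)) dhyp_above. Qed.

(** Cross terms vanish by orthogonality, leaving [- ch ^+ 2 + sh ^+ 2 = -1]. *)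
Lemma mink_hyp k y : (k <= n)%N -> mink (hyp k y) (hyp k y) = -1.
Proof.
elim: k => [_|k IH kn] /=.
  by rewrite /mink !mxE mulr1 big1 ?addr0// => i _; rewrite !mxE mul0r.
rewrite !(minkDl, minkDr, minkZl, minkZr) (IH (ltnW kn)) mink_unit_row1//.
rewrite (minkC (unit_row _ _ _)) !mink_hyp_unit//.
by rewrite -[in RHS](ch2Bsh2 (crd y k)); ring.
Qed.

(** In the inductive step only [- ch * sh] and [sh * ch], both times [crd v k], survive, and they
    cancel. *)
Lemma mink_hyp_dhyp k y v : (k <= n)%N -> mink (hyp k y) (dhyp k y v) = 0.
Proof.
elim: k => [_|k IH kn] /=; first by rewrite mink0r.
rewrite !(minkDl, minkDr, minkZl, minkZr) (IH (ltnW kn)) mink_unit_row1//.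
rewrite !(minkC (unit_row _ _ _)) mink_hyp_unit// mink_dhyp_unit//.
rewrite mink_hyp ?(ltnW kn)//; ring.
Qed.

(** The warped product form of the hyperbolic metric: the direction [sh *: hyp k y + ch *: e_(k+1)]
    of the new coordinate is unit spacelike and orthogonal to [dhyp k y v]. *)
Lemma mink_dhypS k y v : (k < n)%N ->
  mink (dhyp k.+1 y v) (dhyp k.+1 y v) =
  ch (crd y k) ^+ 2 * mink (dhyp k y v) (dhyp k y v) + crd v k ^+ 2.
Proof.
move=> kn /=; rewrite !(minkDl, minkDr, minkZl, minkZr) mink_unit_row1//.
rewrite !(minkC (unit_row _ _ _)) mink_hyp_unit// mink_dhyp_unit//.
rewrite (minkC (dhyp _ _ _) (hyp _ _)) mink_hyp_dhyp ?(ltnW kn)//.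
rewrite mink_hyp ?(ltnW kn)// -[crd v k ^+ 2 in RHS]mulr1.
by rewrite -[in RHS](ch2Bsh2 (crd y k)); ring.
Qed.

Lemma mink_dhyp_ge0 k y v : (k <= n)%N -> 0 <= mink (dhyp k y v) (dhyp k y v).
Proof.
elim: k => [_|k IH kn]; first by rewrite mink0r.
rewrite mink_dhypS//; apply: addr_ge0; last exact: sqr_ge0.
by apply: mulr_ge0; [exact: sqr_ge0|exact/IH/ltnW].
Qed.

Lemma mink_dhyp_gt0 k y v (l : 'I_n) : (k <= n)%N -> (l < k)%N -> v 0 l != 0 ->
  0 < mink (dhyp k y v) (dhyp k y v).
Proof.
move=> + + vl; elim: k => [//|k IH] kn; rewrite ltnS leq_eqVlt mink_dhypS//.
case/orP=> [/eqP <-|lk].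
  rewrite (crdE v); apply: ltr_wpDl; last by rewrite exprn_even_gt0.
  by apply: mulr_ge0; [exact: sqr_ge0|exact/mink_dhyp_ge0/ltnW/ltn_ord].
apply: ltr_wpDr; first exact: sqr_ge0.
by apply: mulr_gt0; [exact/exprn_gt0/ch_gt0|exact: IH (ltnW kn) lk].
Qed.

(* A vector whose coordinates vanish from [k] on moves [hyp m] only through
   [hyp k], scaled by the hyperbolic cosines of the later coordinates. *)
Lemma dhyp_trunc k m y v w c : (k <= m)%N ->
  (forall l, (l < k)%N -> crd w l = c * crd v l) ->
  (forall l, (k <= l < m)%N -> crd w l = 0) ->
  dhyp m y w = (c * \prod_(k <= l < m) ch (crd y l)) *: dhyp k y v.
Proof.
move=> km wv w0; rewrite -(subnKC km) in w0 *; elim: (m - k)%N w0 => [|d IH] w0.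
  (* For [m = k] the claim is homogeneity of [dhyp k] in the first [k] coordinates of the vector. *)
  rewrite addn0 big_geq// mulr1; elim: k wv {km w0} => [|k IH] wv /=.
    by rewrite scaler0.
  rewrite IH => [|l lk]; last by rewrite wv// ltnW.
  by rewrite wv// [RHS]scalerDr !scalerA [ch _ * c]mulrC.
(* The next coordinate of [w] is zero, so this stage only contributes its factor [ch]. *)
rewrite addnS /= w0 ?leq_addr ?addnS ?ltnSn// scale0r addr0.
rewrite IH => [|l /andP[kl ld]]; last by rewrite w0// kl addnS ltnW.
by rewrite big_nat_recr ?leq_addr//= scalerA mulrC mulrA.
Qed.

End Spheres.

(** * The hypersurface and its shape operator *)

Lemma shape_op_unique (R : realType) (n : nat) (M : manifold R n)
    (x xi : M -> 'rV[R]_n.+1) (p : M) (A : 'M[R]_n) :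
  spacelike_hypersurface x -> unit_normal x xi ->
  (forall v, diff_fun x p (v *m A) = - diff_fun xi p v) ->
  shape_op x xi p = A.
Proof.
move=> hx hxi xA; apply/row_matrixP => i; rewrite !rowE.
(* Injectivity of [dx] leaves a single solution of the Weingarten equation. *)
have [_ x_inj _] := hx; apply: (x_inj p).
by rewrite (shape_opP _ _ hx hxi) xA.
Qed.

Section Construction.
Context (R : realType) (n r : nat) (beta : 'I_n -> 'I_r) (e : 'I_r -> nat).
Hypothesis e_le : forall i, (e i <= n)%N.
Hypothesis ltn_e : forall (l : 'I_n) i, (l < e i)%N = (beta l <= i)%N.
Local Notation V := 'rV[R]_n.
Implicit Types (y v : V) (i : 'I_r).

Definition hyp_sum : rV_manifold R n -> 'rV[R]_n.+1 :=
  fun y => \sum_i @hyp R n (e i) y.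
Definition hyp_normal : rV_manifold R n -> 'rV[R]_n.+1 := hyp n.

Definition tail_prod i y : R := \prod_(e i <= l < n) ch (crd y l).

(** Up to sign, the principal radius of curvature. The sum starts at [i] because the summand
    [hyp (e i')] involves the coordinates of the block [i] only when [i <= i']. *)
Definition radius i y : R := \sum_(i' < r | (i <= i')%N) (tail_prod i' y)^-1.

Lemma tail_prod_gt0 i y : 0 < tail_prod i y.
Proof. by apply: prodr_gt0 => l _; exact: ch_gt0. Qed.

Lemma radius_gt0 i y : 0 < radius i y.
Proof.
rewrite /radius (bigD1 i)//=; apply: ltr_wpDr.
  by apply: sumr_ge0 => i' _; rewrite invr_ge0 ltW// tail_prod_gt0.
by rewrite invr_gt0 tail_prod_gt0.
Qed.

(** The larger sum has extra positive terms, among them the one of index [i]. *)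
Lemma radius_lt i i' y : (i < i')%N -> radius i' y < radius i y.
Proof.
move=> ii'; rewrite /radius [ltRHS](bigID (fun k : 'I_r => (i' <= k)%N))/=.
rewrite [X in _ < X + _](eq_bigl (fun k : 'I_r => (i' <= k)%N)) => [|k]; last first.
  by rewrite andbC; case: leqP => //= i'k; rewrite (leq_trans (ltnW ii')).
rewrite ltrDl (bigD1 i)/=; last by rewrite leqnn -ltnNge.
apply: ltr_wpDr; last by rewrite invr_gt0 tail_prod_gt0.
by apply: sumr_ge0 => k _; rewrite invr_ge0 ltW// tail_prod_gt0.
Qed.

Lemma radius_inj y : injective (radius ^~ y).
Proof.
move=> i i' ii'; apply/val_inj/eqP; case: ltngtP => // h.
- by have := radius_lt y h; rewrite ii' ltxx.
- by have := radius_lt y h; rewrite ii' ltxx.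
Qed.

(** A coordinate [l] occurring in [tail_prod i'] satisfies [e i' <= l], that is [i' < beta l]; with
    [i <= i'] it lies outside the block [i]. *)
Lemma radius_indep i (y z : V) :
  (forall l, beta l != i -> y 0 l = z 0 l) -> radius i y = radius i z.
Proof.
move=> yz; apply: eq_bigr => i' ii'; congr (_^-1).
apply: eq_big_nat => l /andP[el ln].
rewrite -[l]/(val (Ordinal ln)) !crdE yz//; apply: contraTneq el => bl.
by rewrite -ltnNge -[l]/(val (Ordinal ln)) ltn_e bl.
Qed.

Lemma diff_hyp_sum y v : diff_fun hyp_sum y v =
  dhyp n y (\row_l (v 0 l * radius (beta l) y)).
Proof.
rewrite /diff_fun /= -deriveE; last first.
  rewrite (_ : _ \o _ = \sum_i @hyp R n (e i)); last first.
    by apply/funext => z; rewrite fct_sumE.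
  by apply: differentiable_sum => i; exact: differentiable_hyp.
rewrite (_ : _ \o _ = \sum_i @hyp R n (e i)); last first.
  by apply/funext => z; rewrite fct_sumE.
rewrite derive_sum; last first.
  by move=> i; apply/diff_derivable/differentiable_hyp.
(* Chosen so that [dhyp n y (w i) = dhyp (e i) y v]: the inverse of [tail_prod i y] cancels the
   factor from [dhyp_trunc]. Since [v 0 l] survives in [w i] exactly when [beta l <= i], summing
   over [i] produces [radius (beta l) y]. *)
pose w i : V := \row_l (if (l < e i)%N then (tail_prod i y)^-1 * v 0 l else 0).
have -> : \row_l (v 0 l * radius (beta l) y) = \sum_i w i.
  apply/rowP => l; rewrite summxE mxE /radius mulr_sumr big_mkcond /=.
  by apply: eq_bigr => i _; rewrite mxE ltn_e mulrC.
rewrite -diff_hyp linear_sum; apply: eq_bigr => i _; rewrite derive_hyp diff_hyp.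
rewrite (@dhyp_trunc _ _ (e i) n y v (w i) (tail_prod i y)^-1) ?e_le//.
- by rewrite mulVf ?scale1r// gt_eqF// tail_prod_gt0.
- move=> l le; have ln := leq_trans le (e_le i).
  by rewrite -[l]/(val (Ordinal ln)) !crdE mxE /= le.
- move=> l /andP[el ln].
  by rewrite -[l]/(val (Ordinal ln)) crdE mxE /= ltnNge el.
Qed.

Lemma diff_hyp_normal y v : diff_fun hyp_normal y v = dhyp n y v.
Proof. exact: diff_hyp. Qed.

Lemma mink_dhypn_gt0 y v : v != 0 -> 0 < mink (dhyp n y v) (dhyp n y v).
Proof. by move=> /rV0Pn[l vl]; exact: (mink_dhyp_gt0 _ _ (ltn_ord l) vl). Qed.

(** The induced metric is the hyperbolic one after rescaling coordinates by positive radii, hence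
    positive definite. Injectivity of [dx] follows, as a kernel vector would have length zero. *)
Lemma hyp_sum_spacelike : spacelike_hypersurface hyp_sum.
Proof.
have scale_neq0 p v : v != 0 -> \row_l (v 0 l * radius (beta l) p) != 0.
  move=> /rV0Pn[l vl]; apply/rV0Pn; exists l; rewrite mxE mulf_neq0//.
  by rewrite gt_eqF// radius_gt0.
split.
- by move=> c ->; apply/exp_sum_smooth/exp_sum_sum => i; exact: exp_sum_hyp.
- move=> p u v uv; apply/eqP; rewrite -subr_eq0; apply/negP => /negP uv0.
  have := mink_dhypn_gt0 p (scale_neq0 p _ uv0).
  rewrite -diff_hyp_sum /diff_fun linearB /=.
  move: uv; rewrite /diff_fun => ->; rewrite subrr mink0r ltxx//.
- move=> p v v0; rewrite diff_hyp_sum; exact/mink_dhypn_gt0/scale_neq0.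
Qed.

Lemma hyp_unit_normal : unit_normal hyp_sum hyp_normal.
Proof.
split.
- by move=> c ->; exact/exp_sum_smooth/exp_sum_hyp.
- by move=> p; exact: mink_hyp.
- by move=> p v; rewrite diff_hyp_sum; exact: mink_hyp_dhyp.
Qed.

Lemma hyp_shape_op p : shape_op hyp_sum hyp_normal p =
  diag_mx (\row_l - (radius (beta l) p)^-1).
Proof.
apply: shape_op_unique hyp_sum_spacelike hyp_unit_normal _ => v.
(* Both sides are values of the differential of [hyp n], so it suffices that the radii cancel their
   inverses coordinatewise. *)
rewrite diff_hyp_sum diff_hyp_normal -!diff_hyp -linearN /=; congr ('d _ _ _).
apply/rowP => l; rewrite rV_diagE !mxE mulrN mulNr -mulrA mulVf ?mulr1//.
by rewrite gt_eqF// radius_gt0.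
Qed.

Lemma curvature_inj p : injective (fun i => - (radius i p)^-1).
Proof. by move=> i i' /oppr_inj /invr_inj; exact: radius_inj. Qed.

Lemma curvature_indep i (y z : V) :
  (forall l, beta l != i -> y 0 l = z 0 l) ->
  - (radius i y)^-1 = - (radius i z)^-1.
Proof. by move=> /radius_indep ->. Qed.

End Construction.

(** * Cutting the coordinates into blocks, and assembly *)

Lemma down_closedE (n : nat) (P : pred 'I_n) :
  (forall l m : 'I_n, (l <= m)%N -> P m -> P l) ->
  forall l : 'I_n, (l < #|P|)%N = P l.
Proof.
move=> Pd l; have cl m : (m <= n)%N -> #|[pred k : 'I_n | (k < m)%N]| = m.
  move=> mn; rewrite -sum1_card.
  by rewrite (big_ord_narrow_cond mn (P := xpredT)) sum1_card card_ord.
(* If [P l] fails, [P] lies strictly below [l]; if it holds, [P] contains everything up to [l]. *)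
apply/idP/idP => [|Pl].
  apply: contraTT => nPl; rewrite -leqNgt -[leqRHS](cl l (ltnW (ltn_ord l))).
  apply/subset_leq_card/fintype.subsetP => m Pm; rewrite inE ltnNge.
  by apply: contra nPl => lm; exact: Pd Pm.
rewrite -(cl l.+1 (ltn_ord l)); apply/subset_leq_card/fintype.subsetP => m.
by rewrite inE ltnS => ml; exact: Pd Pl.
Qed.

Theorem theorem3p3 (R : realType) (n r : nat) (v : 'I_r -> nat)
    (v_gt0 : forall i, (0 < v i)%N) (sum_v : (\sum_(i < r) v i)%N = n) :
  exists (M : manifold R n) (x xi : M -> 'rV[R]_n.+1),
    [/\ [set: M] !=set0,
        spacelike_hypersurface x,
        unit_normal x xi,
        proper_dupin x xi &
        forall p, has_principal_multiplicities x xi p v].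
Proof.
subst n; set n := (\sum_(i < r) v i)%N.
(* An index below the sum of the [v i] encodes a pair of a block and a position in it; [tagnat.Rank]
   is the encoding. *)
pose beta : 'I_n -> 'I_r := @tagnat.sig1 r v.
have betaP i l : beta l = i <-> exists k, @tagnat.Rank r v i k = l.
  split=> [<-|[k <-]]; last exact: tagnat.Rank1K.
  by exists (tagnat.sig2 l); exact: tagnat.sig2K.
have beta_surj i : exists l, beta l = i.
  by exists (@tagnat.Rank r v i (Ordinal (v_gt0 i))); exact: tagnat.Rank1K.
(* As [beta] is monotone, the coordinates counted here are the first [e i] ones. *)
pose e (i : 'I_r) := #|[pred l | (beta l <= i)%N]|.
have e_le i : (e i <= n)%N by rewrite -[leqRHS]card_ord max_card.
have ltn_e (l : 'I_n) i : (l < e i)%N = (beta l <= i)%N.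
  rewrite /e (@down_closedE n [pred l | (beta l <= i)%N])// => k m km /=.
  by apply: leq_trans; exact: (@tagnat.le_sig1 r v).
have shapeE := @hyp_shape_op R n r beta e e_le ltn_e.
exists (rV_manifold R n), (@hyp_sum R n r e), (@hyp_normal R n); split.
- by exists 0.
- exact: hyp_sum_spacelike e_le ltn_e.
- exact: hyp_unit_normal e_le ltn_e.
- split; last exists r.
    exact: (block_dupin beta_surj shapeE (@curvature_inj R n r e)
              (curvature_indep ltn_e)).
  exact: (block_num_principal_curvatures beta_surj shapeE
            (@curvature_inj R n r e)).
- apply: (block_multiplicities beta_surj shapeE (@curvature_inj R n r e)) betaP.
  move=> i k k' /(congr1 val)/eqP; rewrite tagnat.eq_Rank eqxx /=.
  by move=> /eqP/val_inj.
Qed.
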